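(* Let $K$ be a finite field with $|K|=q$, let $W$ be a $K$-vector space of dimension greater than one, and let $m=q+1$. For any tuple $\mathcal{V}=(V_1,\dots,V_m)$ of finite-dimensional subspaces of $W$ there exists at most one tuple $\mathcal{U}=(U_1,\dots,U_m)$ of finite-dimensional subspaces of $W$, up to equivalence of tuples, such that $(\mathcal{U},\mathcal{V})$ is a nontrivial solution of the isometry equation $$\sum_{i=1}^m \frac{1}{|V_i|}\mathbb{1}_{V_i}=\sum_{i=1}^m \frac{1}{|U_i|}\mathbb{1}_{U_i}.$$
   Context: For a subset $X\subseteq W$, $\mathbb{1}_X:W\to\{0,1\}$ is the indicator function of $X$; the isometry equation is an equality of functions on $W$. Tuples $\mathcal{U},\mathcal{V}$ of length $m$ are equivalent, $\mathcal{U}\sim\mathcal{V}$, if there is a permutation $\pi\in S_m$ with $V_i=U_{\pi(i)}$ for all $i\in\{1,\dots,m\}$. A pair $(\mathcal{U},\mathcal{V})$ is a solution if it satisfies the isometry equation; a solution is trivial if $\mathcal{U}\sim\mathcal{V}$ and nontrivial otherwise. *)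

(* Defs.v *)
From mathcomp Require Import all_boot all_order all_fingroup all_algebra finmap.
From mathcomp Require Import mathcomp_extra boolp classical_sets functions.
From mathcomp Require Import cardinality numfun.

Set Implicit Arguments.
Unset Strict Implicit.
Unset Printing Implicit Defensive.

Import Order.TTheory GRing.Theory Num.Theory.
Local Open Scope classical_set_scope.
Local Open Scope ring_scope.

(* [W : lmodType K] may be infinite-dimensional, so subspaces are classical sets
   rather than [{vspace _}], and bases are classical sets as well. *)
Section Dimension.
Variables (K : fieldType) (W : lmodType K).
Implicit Types B V : set W.

Definition subspace V : Prop := GRing.submod_closed (mem V).

Definition linspan B : set W :=
  [set w | exists (s : seq W) (a : W -> K),
     [set` s] `<=` B /\ w = \sum_(x <- s) a x *: x].

Definition linindep B : Prop :=
  forall (s : seq W) (a : W -> K), uniq s -> [set` s] `<=` B ->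
    \sum_(x <- s) a x *: x = 0 -> {in s, forall x, a x = 0}.

Definition is_basis B V : Prop := linindep B /\ linspan B = V.

Definition findim V : Prop := exists2 B, finite_set B & is_basis B V.

(* The dimension is the cardinality of a basis; [`I_n] is [{0, ..., n - 1}]. *)
Definition dim_gt V (n : nat) : Prop :=
  exists2 B, is_basis B V & ~~ (B #<= `I_n)%card.

Definition findim_subspace V : Prop := subspace V /\ findim V.

End Dimension.

Section Isometry.
Variables (K : finFieldType) (W : lmodType K) (m : nat).
Implicit Types U V : 'I_m -> set W.

(* [fset_set] is only meaningful on finite sets; finite-dimensional subspaces
   over the finite field [K] are finite. *)
Definition isometry_fun V : W -> rat :=
  fun w => \sum_(i < m) (#|` fset_set (V i)|%:R)^-1 * \1_(V i) w.

Definition solution U V : Prop := isometry_fun V = isometry_fun U.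

Definition tuple_equiv U V : Prop :=
  exists p : 'S_m, forall i : 'I_m, V i = U (p i).

Definition nontrivial_solution U V : Prop :=
  solution U V /\ ~ tuple_equiv U V.

End Isometry.

(* Main.v *)
Require Import Defs.
From mathcomp Require Import all_boot all_order all_fingroup all_algebra finmap.
From mathcomp Require Import mathcomp_extra boolp classical_sets functions.
From mathcomp Require Import cardinality numfun.
From mathcomp Require Import zify.

(** Cancelling common entries leaves tuples with none in common.  A subspace is
never covered by q proper subspaces, and a maximal entry X of one side of a
solution is covered by the entries of the other side; hence tuples of length at
most q admit only trivial solutions, and in a nontrivial solution of length
q + 1 the two sides have no common entry.  If X is covered by exactly q + 1
proper subspaces, these cut out all the hyperplanes of X through a subspace of
codimension 2, the axis: a point of X lies in exactly one of them or in all.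

If uniqueness failed there would be three pairwise inequivalent tuples s, t, u
with the same weight function.  Let X be an entry of maximal size, say in s.
The weight recognises the axis, so t and u cut X along the same axis.  An entry
of t smaller than X is a hyperplane of X and, comparing weights, an entry of u,
which is impossible; so all entries of all three tuples have the same size.
Modulo the common axis, t, u and s then consist of pairwise skew planes, planes
from different tuples meeting in lines.  For X in t and Y in u, let p span
X :&: Y; two entries A, B of s that miss p both lie in the 3-dimensional space
X + Y, hence intersect: a contradiction. *)

Set Implicit Arguments.
Unset Strict Implicit.
Unset Printing Implicit Defensive.

Import GRing.Theory Num.Theory Order.TTheory.
Local Open Scope ring_scope.

(** * Two facts about sequences *)

Lemma count_uniq_mem (T : eqType) (a : pred T) (s : seq T) (x y : T) :
  x \in s -> y \in s -> a x -> a y -> count a s = 1%N -> x = y.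
Proof.
move=> xs ys ax ay; rewrite (seq.permP (perm_to_rem xs)) /= ax => -[] /eqP.
apply: contraTeq => xy; rewrite -lt0n -has_count.
by apply/hasP; exists y; rewrite ?rem_mem // eq_sym.
Qed.

Lemma ex_max_seq (T : eqType) (f : T -> nat) (s : seq T) : (0 < size s)%N ->
  exists2 x, x \in s & {in s, forall y, f y <= f x}%N.
Proof.
elim: s => // x [_ _|y s /(_ isT) [z zs zmax] _].
  by exists x; rewrite ?mem_head // => y; rewrite inE => /eqP->.
have [le_zx|lt_xz] := leqP (f z) (f x).
  exists x; first exact: mem_head.
  move=> w; rewrite inE => /predU1P[->//|/zmax wz]; exact: leq_trans le_zx.
exists z; first by rewrite inE zs orbT.
by move=> w; rewrite inE => /predU1P[->|/zmax//]; rewrite ltnW.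
Qed.

(** * Finite subspaces and counting along lines *)

Section Subspaces.
Variables (K : finFieldType) (W : lmodType K).
Implicit Types (A B X : {fset W}) (s t u : seq {fset W}) (x y z : W) (c : K).

Definition fsubspace A : Prop := GRing.submod_closed (mem A).

Lemma fsubspace_lin A c x y :
  fsubspace A -> x \in A -> y \in A -> c *: x + y \in A.
Proof. by case=> _ lA xA yA; apply: lA. Qed.

Lemma fsubspaceZ A c x : fsubspace A -> x \in A -> c *: x \in A.
Proof.
by move=> sA xA; rewrite -[c *: x]addr0; apply: fsubspace_lin => //; case: sA.
Qed.

Lemma fsubspaceD A x y : fsubspace A -> x \in A -> y \in A -> x + y \in A.
Proof. by move=> sA xA yA; rewrite -[x]scale1r; apply: fsubspace_lin. Qed.

Lemma fsubspaceB A x y : fsubspace A -> x \in A -> y \in A -> y - x \in A.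
Proof. by move=> sA xA yA; rewrite addrC -scaleN1r; apply: fsubspace_lin. Qed.

Lemma fsubspace_lineP A c x y :
  fsubspace A -> x \in A -> (c *: x + y \in A) = (y \in A).
Proof.
move=> sA xA; apply/idP/idP => [h|]; last exact: fsubspace_lin.
by rewrite -[y](addKr (c *: x)) addrC; apply: fsubspaceB => //; apply: fsubspaceZ.
Qed.

Lemma fsubspace_scaleP A c x :
  fsubspace A -> x \notin A -> c *: x \in A -> c = 0.
Proof.
move=> sA xA cxA; apply: contraNeq xA => c0.
by rewrite -[x](scalerK c0); apply: fsubspaceZ.
Qed.

Lemma fsubspaceI A B : fsubspace A -> fsubspace B -> fsubspace (A `&` B)%fset.
Proof.
move=> sA sB; split; first by rewrite !inE; case: sA => -> _; case: sB.
move=> c x y; rewrite !inE => /andP[xA xB] /andP[yA yB].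
by apply/andP; split; apply: fsubspace_lin.
Qed.

(** The translates of [A] by the multiples of [x] are disjoint and lie in [B]. *)
Lemma card_fsubspace_proper A B x : fsubspace A -> fsubspace B ->
  (A `<=` B)%fset -> x \in B -> x \notin A -> (#|K| * #|` A| <= #|` B|)%N.
Proof.
move=> sA sB /fsubsetP AB xB xA.
rewrite cardE -(size_allpairs (fun c a => c *: x + a)).
apply: (@uniq_leq_size _ [seq c *: x + a | c <- enum K, a <- enum_fset A]).
  apply: allpairs_uniq; [exact: enum_uniq|exact: fset_uniq|].
  move=> [c a] [d b] /allpairsP[[c1 a1] /= [_ a1A [-> ->]]].
  move=> /allpairsP[[d1 b1] /= [_ b1A [-> ->]]] /= e.
  suff cd : c1 - d1 = 0.
    by move/subr0_eq: cd e => -> /addrI ->.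
  apply: (fsubspace_scaleP sA xA); rewrite scalerBl.
  suff -> : c1 *: x - d1 *: x = b1 - a1 by exact: fsubspaceB.
  by apply/eqP; rewrite subr_eq addrAC eq_sym subr_eq e addrC.
move=> y /allpairsP[[c a] /= [_ aA ->]].
by apply: fsubspace_lin => //; apply: AB.
Qed.

Lemma card_le_line A X x :
  {in X, forall y, exists c, c *: x + y \in A} -> (#|` X| <= #|K| * #|` A|)%N.
Proof.
move=> cov; rewrite cardE -(size_allpairs (fun c a => c *: x + a)).
apply: (@uniq_leq_size _ (enum_fset X)
  [seq c *: x + a | c <- enum K, a <- enum_fset A]).
  exact: fset_uniq.
move=> y /cov[c cyA]; apply/allpairsP; exists (- c, c *: x + y) => /=.
by split; rewrite ?mem_enum // scaleNr addKr.
Qed.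

(** * Too few subspaces cannot cover *)

Definition mult t x : nat := count (fun A : {fset W} => x \in A) t.

(* A line [y + K x] whose direction [x] avoids [B] meets [B] at most once. *)
Lemma sum_mult_line t x y : {in t, forall B, fsubspace B} -> mult t x = 0%N ->
  (\sum_(c : K) mult t (c *: x + y)%R <= size t)%N.
Proof.
elim: t => [|B t IH] st; rewrite /mult /=; first by rewrite big1.
move=> /eqP; rewrite addn_eq0 eqb0 => /andP[xB /eqP t0].
rewrite big_split /= -add1n leq_add //; last first.
  by apply: IH => // A At; apply: st; rewrite inE At orbT.
have sB : fsubspace B by apply: st; rewrite mem_head.
rewrite -big_mkcond /= sum1_card; apply/card_le1_eqP => d c dB cB; apply: subr0_eq.
apply: (fsubspace_scaleP sB xB).
by rewrite scalerBl -(addrKA y) [y + _]addrC; apply: (fsubspaceB sB).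
Qed.

(** Induction on [t]. If [x] avoids the tail but lies in [B], take [y] in [X] outside [B]: the line
    [y + K x] misses [B], and its q points cannot all be covered by the tail, where their total
    multiplicity is below q. *)
Lemma not_covered X t : fsubspace X -> {in t, forall B, fsubspace B} ->
  {in t, forall B, ~~ (X `<=` B)%fset} -> (size t <= #|K|)%N ->
  exists2 x, x \in X & mult t x = 0%N.
Proof.
move=> sX; elim: t => [|B t IH] st nt.
  by exists 0 => //; case: sX.
rewrite /= => lt_t; have [|||x xX tx0] := IH.
- by move=> A At; apply: st; rewrite inE At orbT.
- by move=> A At; apply: nt; rewrite inE At orbT.
- exact: ltnW.
have [xB|xB] := boolP (x \in B); last first.
  by exists x; rewrite // /mult /= (negPf xB).
have /fsubsetPn[y yX yB] := nt B (mem_head _ _).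
have sB : fsubspace B by apply: st; rewrite mem_head.
have [/existsP[c /eqP c0]|/existsPn all1] :=
    boolP [exists c, mult t (c *: x + y) == 0%N].
  exists (c *: x + y); first exact: fsubspace_lin.
  by rewrite /mult /= fsubspace_lineP // (negPf yB); apply: c0.
have st' : {in t, forall B, fsubspace B}.
  by move=> A At; apply: st; rewrite inE At orbT.
have := sum_mult_line y st' tx0; rewrite leqNgt => /negP[].
apply: leq_trans lt_t _; rewrite -sum1_card.
by apply: leq_sum => c _; rewrite lt0n.
Qed.

(** * Covers by q + 1 subspaces and their axis *)

Definition min_cover X t : Prop :=
  [/\ fsubspace X, {in t, forall B, fsubspace B},
      {in t, forall B, ~~ (X `<=` B)%fset},
      size t = #|K|.+1 & {in X, forall x, (0 < mult t x)%N}].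

Section MinCover.
Variables (X : {fset W}) (t : seq {fset W}).
Hypothesis coverXt : min_cover X t.

Let sX : fsubspace X. Proof. by case: coverXt. Qed.
Let st : {in t, forall B, fsubspace B}. Proof. by case: coverXt. Qed.
Let nt : {in t, forall B, ~~ (X `<=` B)%fset}. Proof. by case: coverXt. Qed.
Let szt : size t = #|K|.+1. Proof. by case: coverXt. Qed.
Let cov : {in X, forall x, (0 < mult t x)%N}. Proof. by case: coverXt. Qed.

Let mult_rem B x : B \in t -> mult t x = ((x \in B) + mult (rem B t) x)%N.
Proof. by move=> Bt; rewrite /mult (seq.permP (perm_to_rem Bt)). Qed.

Let srem A : {in rem A t, forall B, fsubspace B}.
Proof. by move=> B /mem_rem; apply: st. Qed.

(** Without [B] only q subspaces remain, and they miss some point of [X]. *)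
Lemma cover_private B : B \in t ->
  exists2 x, x \in X & x \in B /\ mult t x = 1%N.
Proof.
move=> Bt; have [|||x xX x0] := @not_covered X (rem B t) sX; first exact: srem.
- by move=> A /mem_rem; apply: nt.
- by rewrite size_rem // szt.
have := cov xX; rewrite (mult_rem _ Bt) x0 addn0 lt0b => xB.
by exists x; rewrite ?(mult_rem _ Bt) ?xB ?x0.
Qed.

(** Let [x] be private to [B]. The line [y + K x] misses [B], so its q points are covered by the
    other q entries, with total multiplicity at most q: each is covered exactly once. *)
Lemma cover_mult_outside B y : B \in t -> y \in X -> y \notin B ->
  mult t y = 1%N.
Proof.
move=> Bt yX yB; have [x xX [xB]] := cover_private Bt.
rewrite !(mult_rem _ Bt) xB (negPf yB) => -[x0].
have := sum_mult_line y (@srem B) x0.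
rewrite size_rem // szt /= (bigD1 0) //= scale0r add0r => le_q.
apply/eqP; rewrite eqn_leq; apply/andP; split; last first.
  by have := cov yX; rewrite (mult_rem _ Bt) (negPf yB).
(* The q - 1 points with [c != 0] use up at least q - 1 of the bound. *)
have : (mult (rem B t) y + #|K|.-1 <= #|K|)%N.
  apply: leq_trans le_q; rewrite leq_add2l -(cardC1 (0 : K)) -sum1_card.
  apply: leq_sum => c _; have := cov (fsubspace_lin c sX xX yX).
  by rewrite (mult_rem _ Bt) fsubspace_lineP ?(negPf yB) //; apply: st.
by have := card_finNzRing_gt1 K; lia.
Qed.

Lemma cover_mult x : x \in X ->
  mult t x = 1%N \/ {in t, forall B, x \in B}.
Proof.
move=> xX; have [allx|/allPn[B Bt xB]] := boolP (all (fun B => x \in B) t).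
  by right; apply/allP.
by left; apply: cover_mult_outside Bt xX xB.
Qed.

(** The line [y + K x] misses [A]. If it missed [B] too, its q points would be left to q - 1
    entries, with total multiplicity at most q - 1. *)
Let transversal_out A B x y : A \in t -> x \in A -> mult t x = 1%N ->
  x \in X -> y \in X -> y \notin A -> B \in t -> x \notin B ->
  exists c, c *: x + y \in B.
Proof.
move=> At xA; rewrite (mult_rem _ At) xA => -[x0] xX yX yA Bt xB.
have BrA : B \in rem A t.
  by rewrite rem_mem //; apply: contraNneq xB => ->.
apply/existsP; apply: contraT => /existsPn noc.
have srem' : {in rem B (rem A t), forall B, fsubspace B}.
  by move=> C /mem_rem; apply: srem.
have multB z : mult (rem A t) z = ((z \in B) + mult (rem B (rem A t)) z)%N.
  by rewrite /mult (seq.permP (perm_to_rem BrA)).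
have x0' : mult (rem B (rem A t)) x = 0%N.
  by move: x0; rewrite multB (negPf xB).
have := sum_mult_line y srem' x0'.
rewrite !size_rem // szt /= leqNgt => /negP[].
have K0 : (0 < #|K|)%N by apply: ltnW; apply: card_finNzRing_gt1.
rewrite prednK // -sum1_card; apply: leq_sum => c _.
have := cov (fsubspace_lin c sX xX yX).
rewrite (mult_rem _ At) fsubspace_lineP ?(negPf yA) ?add0n //; last exact: st.
by rewrite multB (negPf (noc c)).
Qed.

Lemma cover_transversal B x y : mult t x = 1%N -> x \in X -> y \in X ->
  B \in t -> x \notin B -> exists c, c *: x + y \in B.
Proof.
move=> x1 xX yX Bt xB.
have /hasP[A At xA] : has (fun A : {fset W} => x \in A) t.
  by rewrite has_count -/(mult t x) x1.
have out := @transversal_out A B x _ At xA x1 xX _ _ Bt xB.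
have [yA|yA] := boolP (y \in A); last exact: out.
(* For [y] in [A], both [z] and [z + y] lie outside [A]; subtracting the points of [B] found on
   their lines gives one on the line of [y]. *)
have /fsubsetPn[z zX zA] := nt At.
have [c cB] := out z zX zA.
have [||d dB] := out (z + y).
- exact: fsubspaceD.
- apply: contra zA => zyA; rewrite -[z](addrK y).
  by apply: fsubspaceB => //; apply: st.
exists (d - c); suff -> : (d - c) *: x + y = d *: x + (z + y) - (c *: x + z).
  by apply: fsubspaceB => //; apply: st.
by rewrite scalerBl opprD addrACA [z + y]addrC addrK.
Qed.

(** Within [X], an entry is spanned by the axis and any of its points [x] off the axis: the line
    [y + K x] stays in [A] and meets some [B] without [x], at a point of two different entries,
    hence of all. *)
Lemma cover_axis A x y : mult t x = 1%N -> x \in X -> y \in X ->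
  A \in t -> x \in A -> y \in A -> exists c, {in t, forall B, c *: x + y \in B}.
Proof.
move=> x1 xX yX At xA yA.
have [B Bt xB] : exists2 B, B \in t & x \notin B.
  apply/allPn; rewrite all_count -/(mult t x) x1 szt eqSS eq_sym -lt0n.
  by apply: ltnW; apply: card_finNzRing_gt1.
have [c cB] := cover_transversal x1 xX yX Bt xB.
exists c; have [z1|//] := cover_mult (fsubspace_lin c sX xX yX).
have /eqP := count_uniq_mem At Bt (fsubspace_lin c (st At) xA yA) cB z1.
by move=> /eqP eAB; rewrite -eAB xA in xB.
Qed.

(** A point [x] private to another entry gives a direction in which every line of [X] meets [B]. *)
Lemma cover_card B : B \in t -> (#|` X| <= #|K| * #|` (B `&` X)%fset|)%N.
Proof.
move=> Bt; have /hasP[A Ar _] : has predT (rem B t).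
  by rewrite has_predT size_rem // szt /=; apply: ltnW; apply: card_finNzRing_gt1.
have [x xX [xA x1]] := cover_private (mem_rem Ar).
(* [A] survives the removal of [B], so even if they are equal a common point counts twice. *)
have xB : x \notin B.
  apply/negP => xB; move: x1; rewrite (mult_rem _ Bt) xB => -[] /eqP.
  by rewrite -leqn0 leqNgt -has_count => /hasP[]; exists A.
apply: (@card_le_line _ _ x) => y yX.
have [c cB] := cover_transversal x1 xX yX Bt xB.
by exists c; rewrite inE cB fsubspace_lin.
Qed.

(** If [B] leaves [X], it is at least q times as large as its intersection with [X], hence at least
    as large as [X]. *)
Lemma cover_card_or_sub B : B \in t -> (#|` B| < #|` X|)%N -> (B `<=` X)%fset.
Proof.
move=> Bt; apply: contraTT => /fsubsetPn[x xB xX]; rewrite -leqNgt.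
apply: leq_trans (cover_card Bt) _.
apply: (@card_fsubspace_proper _ _ x) => //; last by rewrite inE negb_and xX orbT.
- by apply: fsubspaceI => //; apply: st.
- exact: st.
- exact: fsubsetIl.
Qed.

End MinCover.

(** * Weight functions *)

Definition weight t x : rat := \sum_(A <- t) (#|` A|%:R)^-1 * (x \in A)%:R.

Lemma weight_rem A t x : A \in t ->
  weight t x = (#|` A|%:R)^-1 * (x \in A)%:R + weight (rem A t) x.
Proof. by move=> At; rewrite /weight (big_rem _ At). Qed.

Lemma weight_mult0 t x : mult t x = 0%N -> weight t x = 0.
Proof.
move=> /eqP; rewrite -leqn0 leqNgt -has_count => /hasPn x0.
rewrite /weight big_seq big1 // => A At.
by have /negPf -> := x0 A At; rewrite mulr0.
Qed.

Lemma weight_ge0 t x : 0 <= weight t x.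
Proof. by apply: sumr_ge0 => A _; rewrite mulr_ge0 ?invr_ge0. Qed.

Lemma cardfs_mem_gt0 A x : x \in A -> (0 < #|` A|)%N.
Proof. by move=> xA; rewrite cardfs_gt0; apply/fset0Pn; exists x. Qed.

Lemma weight_gt0 t x : (0 < weight t x) = (0 < mult t x)%N.
Proof.
apply/idP/idP => [|].
  by rewrite lt0n; apply: contraL => /eqP /weight_mult0 ->; rewrite ltxx.
rewrite -has_count => /hasP[A At xA].
rewrite (weight_rem _ At) xA mulr1 ltr_wpDr ?weight_ge0 // invr_gt0 ltr0n.
exact: cardfs_mem_gt0 xA.
Qed.

Lemma weight_mult1 A t x : A \in t -> x \in A -> mult t x = 1%N ->
  weight t x = (#|` A|%:R)^-1.
Proof.
move=> At xA; rewrite /mult (seq.permP (perm_to_rem At)) /= xA => -[] x0.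
by rewrite (weight_rem _ At) xA mulr1 weight_mult0 ?addr0.
Qed.

Lemma weight_all_ge (N : nat) t x : {in t, forall B, x \in B} ->
  {in t, forall B, #|` B| <= N}%N -> (size t)%:R / N%:R <= weight t x.
Proof.
move=> allx leN; have -> : (size t)%:R / N%:R = \sum_(B <- t) (N%:R^-1 : rat).
  by rewrite big_const_seq count_predT iter_addr_0 mulr_natl.
rewrite /weight !big_seq; apply: ler_sum => B Bt.
have := cardfs_mem_gt0 (allx B Bt).
rewrite allx // mulr1 => B0; rewrite lef_pV2 ?posrE ?ltr0n ?ler_nat ?leN //.
by apply: leq_trans (leN _ Bt).
Qed.

Lemma mult_size t x : reflect {in t, forall B, x \in B} (mult t x == size t).
Proof. by rewrite -all_count; apply: allP. Qed.

Lemma weight_const (N : nat) t x : {in t, forall B, #|` B| = N} ->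
  weight t x = (mult t x)%:R / N%:R.
Proof.
move=> cN; rewrite /weight /mult -sum1_count natr_sum big_distrl /=.
rewrite [RHS]big_mkcond /= !big_seq; apply: eq_bigr => B /cN ->.
by case: (x \in B); rewrite ?mulr1 ?mulr0 ?mul1r.
Qed.

(** * Maximal entries and cancellation *)

Section Isometric.
Variables (X : {fset W}) (s t : seq {fset W}).
Hypotheses (ss : {in s, forall B, fsubspace B}).
Hypotheses (st : {in t, forall B, fsubspace B}).
Hypotheses (Xs : X \in s) (maxX : {in t, forall B, #|` B| <= #|` X|}%N).
Hypotheses (wst : weight s =1 weight t) (dst : {in s, forall B, B \notin t}).

Let ntX : {in t, forall B, ~~ (X `<=` B)%fset}.
Proof.
move=> B Bt; apply: contra (dst Xs) => XB.
suff /eqP -> : X == B by [].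
by rewrite eqEfcard XB maxX.
Qed.

Let covX : {in X, forall x, (0 < mult t x)%N}.
Proof.
move=> x xX; rewrite -weight_gt0 -wst weight_gt0 -has_count.
by apply/hasP; exists X.
Qed.

(** Equal weights have equal supports, so [t] covers [X]; by maximality, an entry of [t] containing
    [X] would equal it, against disjointness. *)
Lemma max_size_gt : (#|K| < size t)%N.
Proof.
rewrite ltnNge; apply/negP => /(not_covered (ss Xs) st ntX)[x /covX].
by move=> + x0; rewrite x0.
Qed.

Lemma max_min_cover : size t = #|K|.+1 -> min_cover X t.
Proof. by move=> szt; split=> //; apply: ss. Qed.

End Isometric.

(** Common entries cancel by induction; with none left, a largest entry of either side contradicts
    [max_size_gt]. *)
Lemma isometric_small s t : {in s, forall B, fsubspace B} ->
  {in t, forall B, fsubspace B} -> size s = size t -> (size s <= #|K|)%N ->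
  weight s =1 weight t -> perm_eq s t.
Proof.
have [n] := ubnP (size s); elim: n s t => // n IH s t le_n ss st szst le_q wst.
have [/hasP[A As At]|/hasPn dst] := boolP (has (fun A => A \in t) s).
  rewrite (perm_trans (perm_to_rem As)) // perm_sym.
  rewrite (perm_trans (perm_to_rem At)) // perm_cons perm_sym.
  have s0 : (0 < size s)%N by rewrite -has_predT; apply/hasP; exists A.
  apply: IH.
  - by rewrite size_rem // -ltnS prednK.
  - by move=> B /mem_rem; apply: ss.
  - by move=> B /mem_rem; apply: st.
  - by rewrite !size_rem // szst.
  - by rewrite size_rem //; apply: leq_trans (leq_pred _) le_q.
  - move=> x; have := wst x.
    by rewrite (weight_rem _ As) (weight_rem _ At) => /addrI.
have dts : {in t, forall B, B \notin s}.
  by move=> B Bt; apply: contraL Bt => /dst.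
have [s0|s0] := posnP (size s).
  by rewrite (size0nil s0) (size0nil (etrans (esym szst) s0)).
have [|X] := @ex_max_seq _ (fun A : {fset W} => #|` A|) (s ++ t).
  by rewrite size_cat addn_gt0 s0.
rewrite mem_cat => /orP[Xs|Xt] maxX.
  have maxt : {in t, forall B, #|` B| <= #|` X|}%N.
    by move=> B Bt; apply: maxX; rewrite mem_cat Bt orbT.
  by have := max_size_gt ss st Xs maxt wst dst; rewrite -szst ltnNge le_q.
have maxs : {in s, forall B, #|` B| <= #|` X|}%N.
  by move=> B Bs; apply: maxX; rewrite mem_cat Bs.
by have := max_size_gt st ss Xt maxs (fsym wst) dts; rewrite ltnNge le_q.
Qed.

Lemma isometric_disjoint s t : {in s, forall B, fsubspace B} ->
  {in t, forall B, fsubspace B} -> size s = #|K|.+1 -> size t = #|K|.+1 ->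
  weight s =1 weight t -> ~~ perm_eq s t -> {in s, forall B, B \notin t}.
Proof.
move=> ss st szs szt wst nst A As; apply: contra nst => At.
rewrite (perm_trans (perm_to_rem As)) // perm_sym.
rewrite (perm_trans (perm_to_rem At)) // perm_cons perm_sym.
apply: isometric_small.
- by move=> B /mem_rem; apply: ss.
- by move=> B /mem_rem; apply: st.
- by rewrite !size_rem // szs szt.
- by rewrite size_rem // szs.
- move=> x; have := wst x.
  by rewrite (weight_rem _ As) (weight_rem _ At) => /addrI.
Qed.

(** * Three tuples with the same weight *)

(* Points of the axis of a cover carry weight at least [(q + 1) / |X|], all the
   other points of [X] carry weight at most [q / |X|]. *)
Lemma cover_axis_weight X t u z : min_cover X t -> min_cover X u ->
  {in t, forall B, #|` B| <= #|` X|}%N -> weight t z = weight u z ->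
  z \in X -> {in t, forall B, z \in B} -> {in u, forall B, z \in B}.
Proof.
move=> ct cu leX wtu zX allt; have [z1|//] := cover_mult cu zX.
have /hasP[B Bu zB] : has (fun A : {fset W} => z \in A) u.
  by rewrite has_count -/(mult u z) z1.
have := weight_all_ge allt leX.
rewrite wtu (weight_mult1 Bu zB z1); case: (ct) => _ _ _ -> _.
have B0 := cardfs_mem_gt0 zB; have X0 := cardfs_mem_gt0 zX.
rewrite ler_pdivrMr ?ltr0n // mulrC ler_pdivlMr ?ltr0n // -natrM ler_nat.
have le_I : (#|` (B `&` X)%fset| <= #|` B|)%N by apply/fsubset_leq_card/fsubsetIl.
have := leq_trans (cover_card cu Bu) (leq_mul (leqnn #|K|) le_I).
by move=> le1 le2; move: (leq_trans le2 le1); rewrite mulSn; lia.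
Qed.

(** A smaller entry [B] lies in [X] and is spanned by the axis and a private point [x]. In [u], the
    weight of [x] forces a single entry [C] of the size of [B]; it contains [x] and the axis, so it
    equals [B]. *)
Lemma cover_card_eq X t u : min_cover X t -> min_cover X u ->
  {in t, forall B, #|` B| <= #|` X|}%N -> {in u, forall B, #|` B| <= #|` X|}%N ->
  weight t =1 weight u -> {in t, forall B, B \notin u} ->
  {in t, forall B, #|` B| = #|` X|}.
Proof.
move=> ct cu let_ leu wtu dtu B Bt; apply/eqP; rewrite eqn_leq let_ //= leqNgt.
apply/negP => ltB; have BX := cover_card_or_sub ct Bt ltB.
have [x xX [xB x1]] := cover_private ct Bt.
have ux1 : mult u x = 1%N.
  have [//|/(cover_axis_weight cu ct leu (esym (wtu x)) xX)] := cover_mult cu xX.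
  move=> /mult_size; rewrite x1; case: (ct) => _ _ _ -> _.
  by rewrite eqSS eq_sym eqn0Ngt (ltnW (card_finNzRing_gt1 K)).
have /hasP[C Cu xC] : has (fun A : {fset W} => x \in A) u.
  by rewrite has_count -/(mult u x) ux1.
have cardCB : #|` B| = #|` C|.
  have := wtu x; rewrite (weight_mult1 Bt xB x1) (weight_mult1 Cu xC ux1).
  by move=> /invr_inj /eqP; rewrite eqr_nat => /eqP.
suff BC : (B `<=` C)%fset.
  have /eqP eBC : B == C by rewrite eqEfcard BC cardCB leqnn.
  by have := dtu B Bt; rewrite eBC Cu.
apply/fsubsetP => y yB; have yX := fsubsetP BX y yB.
have sC : fsubspace C by case: cu => _ /(_ C Cu).
have [c allc] := cover_axis ct x1 xX yX Bt xB yB.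
have sX : fsubspace X by case: ct.
have := cover_axis_weight ct cu let_ (wtu _) (fsubspace_lin c sX xX yX) allc Cu.
by rewrite fsubspace_lineP.
Qed.

Lemma no_equal_mult s t u : {in s, forall B, fsubspace B} ->
  size s = #|K|.+1 -> size t = #|K|.+1 -> size u = #|K|.+1 ->
  mult s =1 mult t -> mult s =1 mult u ->
  {in t, forall X, min_cover X s} -> {in t, forall X, min_cover X u} ->
  {in u, forall X, min_cover X s} -> {in u, forall X, min_cover X t} -> False.
Proof.
move=> ss szs szt szu est esu cts ctu cus cut.
have q1 := card_finNzRing_gt1 K.
have [X Xt] : exists X, X \in t.
  by case: (t) szt => // X t' _; exists X; rewrite mem_head.
have [Y Yu] : exists Y, Y \in u.
  by case: (u) szu => // Y u' _; exists Y; rewrite mem_head.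
have sX : fsubspace X by case: (cts X Xt).
have [p pX [pY p1]] := cover_private (ctu X Xt) Yu.
have sp1 : mult s p = 1%N by rewrite esu.
(* Some [Z] in [t] contains [z] and is covered by [s]; lying in two entries, [z] is on the axis, so
   it has full multiplicity in [s] and hence in [t]. *)
have allP z A B : A \in s -> B \in s -> A != B -> z \in A -> z \in B ->
    {in s, forall C, z \in C} /\ {in t, forall C, z \in C}.
  move=> As Bs AB zA zB.
  have /hasP[Z Zt zZ] : has (fun C : {fset W} => z \in C) t.
    by rewrite has_count -/(mult t z) -est -has_count; apply/hasP; exists A.
  have [z1|alls] := cover_mult (cts Z Zt) zZ.
    by rewrite (count_uniq_mem As Bs zA zB z1) eqxx in AB.
  by split=> //; apply/mult_size; rewrite -est szt -szs; apply/mult_size.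
have not_all z : mult s z = 1%N -> ~ {in s, forall C, z \in C}.
  by move=> z1 /mult_size; rewrite z1 szs eqSS eq_sym eqn0Ngt (ltnW q1).
(* Only one entry of [s] contains [p], which leaves at least two since q > 1; a private point of [B]
   shows that they differ. *)
have [A [B [[As Bs] AB [pA pB]]]] : exists A B : {fset W},
    [/\ A \in s /\ B \in s, A != B & p \notin A /\ p \notin B].
  have /hasP[P Ps pP] : has (fun C : {fset W} => p \in C) s.
    by rewrite has_count -/(mult s p) sp1.
  have := size_rem Ps; rewrite szs /=.
  have mrem z : mult s z = ((z \in P) + mult (rem P s) z)%N.
    by rewrite /mult (seq.permP (perm_to_rem Ps)).
  have memr C : C \in rem P s -> C \in s by exact: mem_rem.
  move: mrem memr; case: (rem P s) => [|A [|B r]] mrem memr /= szr;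
    rewrite -szr // in q1.
  have As : A \in s by apply: memr; rewrite mem_head.
  have Bs : B \in s by apply: memr; rewrite !inE eqxx orbT.
  exists A, B; move: sp1; rewrite mrem pP /mult /= => -[/eqP].
  rewrite !addn_eq0 !eqb0 => /and4P[_ pA pB _].
  have [b bX [bB b1]] := cover_private (cts X Xt) Bs.
  split=> //; apply/eqP => eAB; move: b1; rewrite mrem /mult /= eAB bB /=.
  by rewrite addnCA add1n => -[]; rewrite addnCA.
have sA := ss A As; have sB := ss B Bs.
have [b bX [bB b1]] := cover_private (cts X Xt) Bs.
have [b' bY [b'B b'1]] := cover_private (cus Y Yu) Bs.
have [d dA] := cover_transversal (cts X Xt) sp1 pX bX As pA.
have [d' d'A] := cover_transversal (cus Y Yu) sp1 pY bY As pA.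
(* Eliminating [p] between two points of [A] yields a combination of points of [B], so a point of
   both, which lies on the axis. *)
have zE : d' *: (d *: p + b) - d *: (d' *: p + b') = d' *: b - d *: b'.
  by rewrite !scalerDr !scalerA mulrC opprD addrACA subrr add0r.
have zA : d' *: b - d *: b' \in A.
  by rewrite -zE; apply: fsubspaceB => //; apply: fsubspaceZ.
have zB : d' *: b - d *: b' \in B.
  by apply: fsubspaceB => //; apply: fsubspaceZ.
have [_ /(_ X Xt) zX] := allP _ _ _ As Bs AB zA zB.
have d0 : d != 0.
  apply/eqP => d0; apply: (not_all b b1).
  by have [] := allP b A B As Bs AB _ bB; rewrite d0 scale0r add0r in dA.
have b'X : b' \in X.
  rewrite -[b'](scalerK d0); apply: fsubspaceZ => //.
  rewrite -[d *: b'](subKr (d' *: b)).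
  by apply: fsubspaceB => //; apply: fsubspaceZ.
(* Now [b'] and [p] both lie in [X] and [Y], so they agree up to a scalar modulo the axis; as [p] is
   not in [B], this puts [b'] itself on the axis. *)
have [c allc] : exists c, {in t, forall C, c *: p + b' \in C}.
  by apply: (cover_axis (cut Y Yu) _ pY bY Xt pX b'X); rewrite -est.
have alls : {in s, forall C, c *: p + b' \in C}.
  by apply/mult_size; rewrite est szs -szt; apply/mult_size.
have c0 : c = 0.
  apply: (fsubspace_scaleP sB pB); rewrite -[c *: p](addrK b').
  by apply: fsubspaceB => //; apply: alls.
by apply: (not_all b' b'1) => C /alls; rewrite c0 scale0r add0r.
Qed.

(** [cover_card_eq] gives all entries of [t] and [u] the size of [X], so each of them is maximal too
    and is covered by the other two tuples. *)
Lemma isometric_triple s t u X :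
  {in s, forall B, fsubspace B} -> {in t, forall B, fsubspace B} ->
  {in u, forall B, fsubspace B} ->
  size s = #|K|.+1 -> size t = #|K|.+1 -> size u = #|K|.+1 ->
  weight s =1 weight t -> weight s =1 weight u ->
  {in s, forall B, B \notin t} -> {in s, forall B, B \notin u} ->
  {in t, forall B, B \notin u} ->
  X \in s -> {in s ++ t ++ u, forall B, #|` B| <= #|` X|}%N -> False.
Proof.
move=> ss st su szs szt szu wst wsu dst dsu dtu Xs maxX.
have sym (a b : seq {fset W}) :
    {in a, forall B, B \notin b} -> {in b, forall B, B \notin a}.
  by move=> dab B Bb; apply: contraL Bb => /dab.
have wtu : weight t =1 weight u by move=> x; rewrite -wst wsu.
have maxs : {in s, forall B, #|` B| <= #|` X|}%N.
  by move=> B Bs; apply: maxX; rewrite !mem_cat Bs.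
have maxt : {in t, forall B, #|` B| <= #|` X|}%N.
  by move=> B Bt; apply: maxX; rewrite !mem_cat Bt orbT.
have maxu : {in u, forall B, #|` B| <= #|` X|}%N.
  by move=> B Bu; apply: maxX; rewrite !mem_cat Bu !orbT.
have ct := max_min_cover ss st Xs maxt wst dst szt.
have cu := max_min_cover ss su Xs maxu wsu dsu szu.
have eqt := cover_card_eq ct cu maxt maxu wtu dtu.
have equ := cover_card_eq cu ct maxu maxt (fsym wtu) (sym _ _ dtu).
have cts : {in t, forall Y, min_cover Y s}.
  move=> Y Yt; apply: (max_min_cover st ss Yt _ (fsym wst) (sym _ _ dst) szs).
  by rewrite (eqt Y Yt).
have ctu : {in t, forall Y, min_cover Y u}.
  move=> Y Yt; apply: (max_min_cover st su Yt _ wtu dtu szu).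
  by rewrite (eqt Y Yt).
have cus : {in u, forall Y, min_cover Y s}.
  move=> Y Yu; apply: (max_min_cover su ss Yu _ (fsym wsu) (sym _ _ dsu) szs).
  by rewrite (equ Y Yu).
have cut : {in u, forall Y, min_cover Y t}.
  move=> Y Yu; apply: (max_min_cover su st Yu _ (fsym wtu) (sym _ _ dtu) szt).
  by rewrite (equ Y Yu).
(* The size argument again, with an entry [Y] of [t] covered by [s] and [u]. *)
have eqs : {in s, forall B, #|` B| = #|` X|}.
  have [Y Yt] : exists Y, Y \in t.
    by case: (t) szt => // Y t' _; exists Y; rewrite mem_head.
  move=> B Bs; rewrite -(eqt Y Yt).
  apply: (cover_card_eq (cts Y Yt) (ctu Y Yt)) => //; rewrite (eqt Y Yt) //.
have X0 : (#|` X|%:R : rat) != 0.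
  by rewrite pnatr_eq0 -lt0n; apply: (@cardfs_mem_gt0 _ 0); case: (ss X Xs).
have emult (a b : seq {fset W}) : {in a, forall B, #|` B| = #|` X|} ->
    {in b, forall B, #|` B| = #|` X|} -> weight a =1 weight b -> mult a =1 mult b.
  move=> ea eb wab x; have := wab x.
  rewrite (weight_const _ ea) (weight_const _ eb).
  by move=> /(divIf X0) /eqP; rewrite eqr_nat => /eqP.
exact: (no_equal_mult ss szs szt szu (emult _ _ eqs eqt wst)
  (emult _ _ eqs equ wsu)).
Qed.

(** Pairwise inequivalent tuples would play symmetric roles, so whichever holds a largest entry can
    be put first. *)
Lemma isometric_unique s t u :
  {in s, forall B, fsubspace B} -> {in t, forall B, fsubspace B} ->
  {in u, forall B, fsubspace B} ->
  size s = #|K|.+1 -> size t = #|K|.+1 -> size u = #|K|.+1 ->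
  weight s =1 weight t -> weight s =1 weight u ->
  ~~ perm_eq s t -> ~~ perm_eq s u -> perm_eq t u.
Proof.
move=> ss st su szs szt szu wst wsu nst nsu; apply: contraT => ntu.
have wtu : weight t =1 weight u by move=> x; rewrite -wst wsu.
have wts := fsym wst; have wus := fsym wsu; have wut := fsym wtu.
have nts : ~~ perm_eq t s by rewrite perm_sym.
have nus : ~~ perm_eq u s by rewrite perm_sym.
have nut : ~~ perm_eq u t by rewrite perm_sym.
have dis := isometric_disjoint.
have [|X] := @ex_max_seq _ (fun A : {fset W} => #|` A|) (s ++ t ++ u).
  by rewrite size_cat szs.
rewrite !mem_cat => /or3P[Xs|Xt|Xu] maxX.
- by case: (@isometric_triple s t u X) => //; apply: dis.
- case: (@isometric_triple t s u X) => //; try exact: dis.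
  by move=> B BB; apply: maxX; move: BB; rewrite !mem_cat orbCA.
- case: (@isometric_triple u s t X) => //; try exact: dis.
  by move=> B BB; apply: maxX; move: BB; rewrite !mem_cat orbC orbA.
Qed.

End Subspaces.

(** * From sets and indexed families to finite sets and sequences *)

Lemma linspan_finite (K : finFieldType) (W : lmodType K) (B : set W) :
  finite_set B -> finite_set (linspan B).
Proof.
move=> /finite_fsetP[b ->].
pose comb (g : {ffun b -> K}) := \sum_(y : b) g y *: val y.
suff sub : (linspan [set` b] `<=` range comb)%classic.
  by apply: sub_finite_set sub _; apply: finite_image; apply: finite_finset.
move=> w [s [a [sb ->]]]; elim: s sb => [|x s IH] sb.
  exists 0 => //; rewrite big_nil; apply: big1 => y _.
  by rewrite ffunE scale0r.
have xb : x \in b by apply: sb; rewrite /= mem_head.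
have [|g _ gE] := IH; first by move=> y ys; apply: sb; rewrite /= inE ys orbT.
(* Coefficients are added, since [linspan] allows repeated vectors. *)
exists ([ffun y => a x * (y == [` xb]%fset)%:R] + g) => //.
rewrite big_cons -gE /comb.
under eq_bigr do rewrite ffunE scalerDl ffunE.
rewrite big_split /=; congr (_ + _).
rewrite (bigD1 [` xb]%fset) //= eqxx mulr1 big1 ?addr0 // => y /negPf ->.
by rewrite mulr0 scale0r.
Qed.

Section Tuples.
Variables (K : finFieldType) (W : lmodType K).

Lemma findim_subspace_finite (V : set W) : findim_subspace V -> finite_set V.
Proof. by case=> _ [B finB [_ <-]]; apply: linspan_finite. Qed.

Lemma fsubspace_fset_set (V : set W) :
  findim_subspace V -> fsubspace (fset_set V).
Proof.
move=> fV; have eV x : (x \in mem (fset_set V)) = (x \in mem V).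
  exact: in_fset_set (findim_subspace_finite fV) x.
case: fV => -[V0 linV] _; split; first by rewrite eV.
by move=> c x y; rewrite !eV; apply: linV.
Qed.

Definition fset_tuple m (V : 'I_m -> set W) : m.-tuple {fset W} :=
  [tuple fset_set (V i) | i < m].

Lemma weight_fset_tuple m (V : 'I_m -> set W) :
  (forall i, findim_subspace (V i)) -> weight (fset_tuple V) =1 isometry_fun V.
Proof.
move=> fV x; rewrite /weight /isometry_fun big_tuple; apply: eq_bigr => i _.
rewrite tnth_mktuple in_fset_set ?indicE //; exact: findim_subspace_finite.
Qed.

Lemma tuple_equivP m (U V : 'I_m -> set W) :
  (forall i, findim_subspace (U i)) -> (forall i, findim_subspace (V i)) ->
  tuple_equiv U V <-> perm_eq (fset_tuple V) (fset_tuple U).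
Proof.
move=> fU fV; split=> [[p VU]|/tuple_permP[p eVU]].
  apply/tuple_permP; exists p; congr val; apply: eq_from_tnth => i.
  by rewrite !tnth_mktuple VU.
exists p => i; apply: fset_set_inj; try exact: findim_subspace_finite.
have /(congr1 (fun t => tnth t i)) := val_inj eVU.
by rewrite !tnth_mktuple.
Qed.

End Tuples.

Theorem proposition6 (K : finFieldType) (q : nat) (hq : #|K| = q)
    (W : lmodType K) (hW : dim_gt [set: W]%classic 1)
    (m : nat) (hm : m = q.+1)
    (V : 'I_m -> set W) (hV : forall i, findim_subspace (V i))
    (U U' : 'I_m -> set W)
    (hU : forall i, findim_subspace (U i))
    (hU' : forall i, findim_subspace (U' i))
    (hUV : nontrivial_solution U V) (hU'V : nontrivial_solution U' V) :
  tuple_equiv U U'.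
Proof.
have size_ft (T : 'I_m -> set W) : size (fset_tuple T) = #|K|.+1.
  by rewrite size_tuple hm hq.
have sub_ft (T : 'I_m -> set W) : (forall i, findim_subspace (T i)) ->
    {in fset_tuple T, forall B, fsubspace B}.
  by move=> fT B /tnthP[i ->]; rewrite tnth_mktuple; apply: fsubspace_fset_set.
have weight_ft (T : 'I_m -> set W) : (forall i, findim_subspace (T i)) ->
    solution T V -> weight (fset_tuple V) =1 weight (fset_tuple T).
  by move=> fT VT x; rewrite !weight_fset_tuple // VT.
case: hUV => solU ntU; case: hU'V => solU' ntU'.
(* [V] is the reference tuple from which both others differ. *)
apply/tuple_equivP => //; apply: (@isometric_unique _ _ (fset_tuple V)) => //;
  try (exact: sub_ft); try (exact: weight_ft).
- by apply/negP => /tuple_equivP; apply: contra_not ntU' => h; apply: h.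
- by apply/negP => /tuple_equivP; apply: contra_not ntU => h; apply: h.
Qed.
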